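(* Let $\kappa\in\mathbb{R}$ and let $D_\kappa=\{\lambda\in\mathbb{C}:\operatorname{Re}[i(\kappa^2+\lambda^2)^2]>0\}$. For $\epsilon>0$ small enough, the function $\nu_\kappa(\lambda):=\sqrt{-\lambda^2-2\kappa^2}^{\,*}$ is analytic on $\overline{D_\kappa}\setminus\{\pm i\sqrt{2}|\kappa|\}$. Moreover, $\operatorname{Im}\nu_\kappa(\lambda)\ge 0$ for $\lambda\in D_\kappa$.
   Context: For fixed $\epsilon>0$, the square root branch $\sqrt{\cdot}^{\,*}$ is defined by $\sqrt{z}^{\,*}:=|z|^{1/2}e^{i\arg(z)/2}$ with $\arg z\in[\epsilon,2\pi+\epsilon)$ (and $\sqrt{0}^{\,*}=0$). $\overline{D_\kappa}$ is the closure of $D_\kappa$ in $\mathbb{C}$. A function is analytic on a (not necessarily open) set if it is analytic in an open neighbourhood of each point of the set. *)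

(* Defs.v *)
From Stdlib Require Import Reals Lra ClassicalEpsilon.
From Coquelicot Require Import Coquelicot.

Open Scope R_scope.

(* e^{i t} for real t. *)
Definition cis (t : R) : C := (cos t, sin t).

Definition is_carg (eps : R) (z : C) (t : R) : Prop :=
  eps <= t < 2 * PI + eps /\ z = (RtoC (Cmod z) * cis t)%C.

(* The argument of z in [eps, 2 PI + eps): it exists for every z ([carg_spec])
   and is unique for z <> 0 ([is_carg_unique]).  For z = 0 every angle of the
   interval qualifies and carg is some unspecified one of them. *)
Definition carg (eps : R) (z : C) : R :=
  epsilon (inhabits 0) (is_carg eps z).

(* |z|^{1/2} e^{i arg(z)/2}; the modulus factor makes it 0 at z = 0. *)
Definition csqrt (eps : R) (z : C) : C :=
  (RtoC (sqrt (Cmod z)) * cis (carg eps z / 2))%C.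

Definition Dk (kappa : R) (lambda : C) : Prop :=
  0 < Re (Ci * (RtoC kappa ^ 2 + lambda ^ 2) ^ 2)%C.

Definition nu (eps kappa : R) (lambda : C) : C :=
  csqrt eps (- lambda ^ 2 - 2 * RtoC kappa ^ 2)%C.

Definition closure (S : C -> Prop) (z : C) : Prop :=
  forall P : C -> Prop, locally z P -> exists w : C, P w /\ S w.

(* f is the sum of a power series centred at z on some disc around z. *)
Definition analytic_at (f : C -> C) (z : C) : Prop :=
  exists (a : nat -> C) (r : R), 0 < r /\
    forall w : C, Cmod (w - z)%C < r ->
      @is_pseries C_AbsRing C_NormedModule a (w - z)%C (f w).

Definition analytic_on (f : C -> C) (S : C -> Prop) : Prop :=
  forall z : C, S z ->
    exists U : C -> Prop,
      open U /\ U z /\ forall w : C, U w -> analytic_at f w.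

Lemma cis_add (s t : R) : cis (s + t) = (cis s * cis t)%C.
Proof.
  unfold cis, Cmult; simpl; rewrite cos_plus, sin_plus.
  f_equal; ring.
Qed.

Lemma cis_0 : cis 0 = 1%C.
Proof. unfold cis; rewrite cos_0, sin_0; reflexivity. Qed.

Lemma Cmod_cis (t : R) : Cmod (cis t) = 1.
Proof.
  unfold cis, Cmod; simpl.
  replace (cos t * (cos t * 1) + sin t * (sin t * 1)) with 1.
  - exact sqrt_1.
  - pose proof (sin2_cos2 t) as H; unfold Rsqr in H; lra.
Qed.

Lemma polar_unit (x y : R) :
  x * x + y * y = 1 -> exists t : R, 0 <= t < 2 * PI /\ cis t = (x, y).
Proof.
  intros H.
  assert (Hx : -1 <= x <= 1) by (split; nra).
  pose proof (acos_bound x) as Hb; pose proof PI_RGT_0 as Hpi.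
  assert (Hc : cos (acos x) = x) by (apply cos_acos; lra).
  assert (Hs : sin (acos x) = sqrt (y * y)).
  { rewrite sin_acos by lra. f_equal. unfold Rsqr. lra. }
  destruct (Rle_lt_dec 0 y) as [Hy | Hy].
  - exists (acos x); split; [lra |].
    unfold cis; rewrite Hc, Hs, sqrt_square by lra; reflexivity.
  - replace (y * y) with ((- y) * (- y)) in Hs by ring.
    rewrite sqrt_square in Hs by lra.
    exists (2 * PI - acos x); split.
    + split; [lra |].
      assert (acos x <> 0); [| lra].
      intros E; rewrite E, sin_0 in Hs; lra.
    + unfold cis.
      replace (2 * PI - acos x) with (- acos x + 2 * INR 1 * PI) by (simpl; ring).
      rewrite cos_period, sin_period, cos_neg, sin_neg, Hc, Hs.
      f_equal; ring.
Qed.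

Lemma is_carg_exists (eps : R) (z : C) : exists t : R, is_carg eps z t.
Proof.
  pose proof PI_RGT_0 as Hpi.
  destruct (Ceq_dec z 0%C) as [-> | Hz].
  - exists eps; split; [lra |].
    rewrite Cmod_0; ring.
  - assert (Hm : 0 < Cmod z) by (apply Cmod_gt_0; exact Hz).
    assert (Hm' : RtoC (Cmod z) <> 0%C) by (intros E; apply RtoC_inj in E; lra).
    pose (w := (z / RtoC (Cmod z) * cis (- eps))%C).
    assert (Hw : Cmod w = 1).
    { unfold w; rewrite Cmod_mult, Cmod_cis, Cmod_div by exact Hm'.
      rewrite Cmod_R, Rabs_pos_eq by lra. field; lra. }
    destruct (polar_unit (Re w) (Im w)) as [t [Ht E]].
    { pose proof (Cmod2_alt w) as H; rewrite Hw in H; nra. }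
    exists (t + eps); split; [lra |].
    replace (Re w, Im w) with w in E by (destruct w; reflexivity).
    rewrite cis_add, E; unfold w.
    replace (z / Cmod z * cis (- eps) * cis eps)%C
      with (z / Cmod z * (cis (- eps) * cis eps))%C by ring.
    rewrite <- cis_add.
    replace (- eps + eps) with 0 by ring.
    rewrite cis_0. field; exact Hm'.
Qed.

Lemma carg_spec (eps : R) (z : C) : is_carg eps z (carg eps z).
Proof. unfold carg; apply epsilon_spec, is_carg_exists. Qed.

Lemma is_carg_unique (eps : R) (z : C) (s t : R) :
  z <> 0%C -> is_carg eps z s -> is_carg eps z t -> s = t.
Proof.
  intros Hz [Hs Es] [Ht Et].
  assert (Hm : 0 < Cmod z) by (apply Cmod_gt_0; exact Hz).
  rewrite Et in Es at 1.
  unfold cis, Cmult, RtoC in Es; simpl in Es.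
  injection Es as E1 E2.
  assert (Ec : cos s = cos t) by nra.
  assert (En : sin s = sin t) by nra.
  assert (Hcos : cos (s - t) = 1).
  { rewrite cos_minus, Ec, En.
    pose proof (sin2_cos2 t) as H; unfold Rsqr in H; lra. }
  replace (s - t) with (2 * ((s - t) / 2)) in Hcos by field.
  rewrite cos_2a_sin in Hcos.
  assert (H0 : sin ((s - t) / 2) = 0) by nra.
  destruct (Rtotal_order s t) as [H | [H | H]]; [| exact H |].
  - assert (0 < sin (- ((s - t) / 2))) by (apply sin_gt_0; lra).
    rewrite sin_neg in *; lra.
  - assert (0 < sin ((s - t) / 2)) by (apply sin_gt_0; lra).
    lra.
Qed.

(* Main.v *)
(* With z = - lambda^2 - 2 kappa^2, the closure of D_kappa is contained in
   (Re z + kappa^2) Im z <= 0, so z never enters the open first quadrant; for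
   eps < PI/2 it meets the branch cut arg z = eps only at z = 0.  At a point l
   off the cut, z(l + h) / z(l) = 1 + p h + q h^2, whose formal square root
   converges for small h by a majorant argument.  The branch is identified by a
   half-plane: all values of the square root satisfy Im (e^{-i eps/2} v) >= 0,
   while nu(l) times the series stays in the open half-plane. *)
Require Import Defs.
From Stdlib Require Import Reals.
From Coquelicot Require Import Coquelicot.
From Stdlib Require Import Lra Lia.
Open Scope R_scope.

(** * Complex series through their real and imaginary parts *)

Lemma re_sum_n (a : nat -> C) (n : nat) :
  Re (sum_n a n) = sum_n (fun k => Re (a k)) n.
Proof.
  induction n as [| n IH]; [now rewrite !sum_O |].
  now rewrite !sum_Sn, <- IH.
Qed.

Lemma im_sum_n (a : nat -> C) (n : nat) :
  Im (sum_n a n) = sum_n (fun k => Im (a k)) n.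
Proof.
  induction n as [| n IH]; [now rewrite !sum_O |].
  now rewrite !sum_Sn, <- IH.
Qed.

(** The projections are continuous, and a ball of [C] is a product of two real balls. This lets real
    comparison and Cauchy product theorems be used for complex series. *)
Lemma is_series_C (a : nat -> C) (l : C) :
  @is_series C_AbsRing C_NormedModule a l <->
  is_series (fun n => Re (a n)) (Re l) /\ is_series (fun n => Im (a n)) (Im l).
Proof.
  split.
  - intros H; split.
    + apply (filterlim_ext (fun n => Re (sum_n a n))); [apply re_sum_n |].
      apply (filterlim_comp _ _ _ _ _ _ _ _ H).
      destruct l as [x y]; exact (@continuous_fst R_UniformSpace R_UniformSpace x y).
    + apply (filterlim_ext (fun n => Im (sum_n a n))); [apply im_sum_n |].
      apply (filterlim_comp _ _ _ _ _ _ _ _ H).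
      destruct l as [x y]; exact (@continuous_snd R_UniformSpace R_UniformSpace x y).
  - intros [H1 H2].
    apply (@filterlim_locally nat C_UniformSpace eventually _); intros e.
    generalize (proj1 (filterlim_locally _ _) H1 e); intros E1.
    generalize (proj1 (filterlim_locally _ _) H2 e); intros E2.
    generalize (filter_and _ _ E1 E2); apply filter_imp.
    intros n [A B]; rewrite <- re_sum_n in A; rewrite <- im_sum_n in B.
    exact (conj A B).
Qed.

Lemma im_le_Cmod (c : C) : Rabs (Im c) <= Cmod c.
Proof.
  apply Rsqr_incr_0_var; [| apply Cmod_ge_0].
  rewrite <- Rsqr_abs; unfold Rsqr.
  pose proof (Cmod2_alt c); nra.
Qed.

Lemma ex_series_bounded (c : nat -> R) (M : R) :
  (forall n, 0 <= c n) -> (forall n, sum_f_R0 c n <= M) -> ex_series c.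
Proof.
  intros Hc HM.
  destruct (ex_finite_lim_seq_incr (sum_n c) M) as [l Hl].
  - intros n; rewrite sum_Sn; unfold plus; simpl; specialize (Hc (S n)); lra.
  - intros n; rewrite sum_n_Reals; apply HM.
  - exists l; exact Hl.
Qed.

Lemma re_sum_f_R0 (a : nat -> C) n :
  Re (sum_n a n) = sum_f_R0 (fun k => Re (a k)) n.
Proof. rewrite re_sum_n; apply sum_n_Reals. Qed.

Lemma im_sum_f_R0 (a : nat -> C) n :
  Im (sum_n a n) = sum_f_R0 (fun k => Im (a k)) n.
Proof. rewrite im_sum_n; apply sum_n_Reals. Qed.

(** * Convolutions and convergence of the square root series *)

Definition conv (a b : nat -> C) (n : nat) : C :=
  sum_n (fun k => (a k * b (n - k)%nat)%C) n.

Lemma Cmod_sum_n (a : nat -> C) (n : nat) :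
  Cmod (sum_n a n) <= sum_f_R0 (fun k => Cmod (a k)) n.
Proof.
  induction n as [| n IH]; [rewrite sum_O; simpl; lra |].
  rewrite sum_Sn; simpl.
  eapply Rle_trans; [apply Cmod_triangle | lra].
Qed.

(** Both sides add [c k * d j] over the triangle [k + j <= n], by antidiagonals on the left and by
    rows on the right. *)
Lemma sum_conv (c d : nat -> R) (n : nat) :
  sum_f_R0 (fun m => sum_f_R0 (fun k => c k * d (m - k)%nat) m) n =
  sum_f_R0 (fun k => c k * sum_f_R0 d (n - k)) n.
Proof.
  induction n as [| n IH]; [reflexivity |].
  rewrite tech5, IH, !(tech5 _ n), Nat.sub_diag, <- Rplus_assoc, <- sum_plus.
  f_equal; apply sum_eq; intros i Hi.
  replace (S n - i)%nat with (S (n - i)) by lia.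
  rewrite tech5; ring.
Qed.

Lemma sum_f_R0_mono (c : nat -> R) (m n : nat) :
  (forall k, 0 <= c k) -> (m <= n)%nat -> sum_f_R0 c m <= sum_f_R0 c n.
Proof.
  intros Hc H; induction H as [| n _ IH]; [lra |].
  rewrite tech5; specialize (Hc (S n)); lra.
Qed.

(* Because [c 0 = 0], the terms of index [S n] do not occur in the convolution. *)
Lemma sum_conv_le (c : nat -> R) (n : nat) :
  c 0%nat = 0 -> (forall k, 0 <= c k) ->
  sum_f_R0 (fun m => sum_f_R0 (fun k => c k * c (m - k)%nat) m) (S n) <=
  sum_f_R0 c n * sum_f_R0 c n.
Proof.
  intros H0 Hc; rewrite sum_conv, tech5, Nat.sub_diag; change (sum_f_R0 c 0) with (c 0%nat).
  rewrite H0, Rmult_0_r, Rplus_0_r, scal_sum.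
  apply sum_Rle; intros [| k] Hk; [rewrite H0; lra |].
  apply Rmult_le_compat_l; [apply Hc |].
  apply sum_f_R0_mono; [exact Hc | lia].
Qed.

(* Majorant argument: the partial sums [s n] of [Cmod (g k)] satisfy
   [2 * s (S n) <= sigma + s n ^ 2]. *)
Lemma sqrt_coeff_sum_le (P g : nat -> C) (sigma : R) :
  g 0%nat = 0%C ->
  (forall n, (2 * g n + conv g g n)%C = P n) ->
  sigma <= 1 ->
  (forall n, sum_f_R0 (fun k => Cmod (P k)) n <= sigma) ->
  forall n, sum_f_R0 (fun k => Cmod (g k)) n <= sigma.
Proof.
  intros g0 g_rec sigma_le1 P_sum n.
  assert (Hs : 0 <= sigma).
  { eapply Rle_trans; [| apply (P_sum 0%nat)]; simpl; apply Cmod_ge_0. }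
  induction n as [| n IH]; [simpl; rewrite g0, Cmod_0; exact Hs |].
  assert (Hpos : 0 <= sum_f_R0 (fun k => Cmod (g k)) n)
    by (apply cond_pos_sum; intros; apply Cmod_ge_0).
  assert (Hterm : forall k, Cmod (g k) * 2 <=
    Cmod (P k) + sum_f_R0 (fun j => Cmod (g j) * Cmod (g (k - j)%nat)) k).
  { intros k.
    replace (Cmod (g k) * 2) with (Cmod (P k - conv g g k)%C).
    - unfold Cminus; eapply Rle_trans; [apply Cmod_triangle |].
      rewrite Cmod_opp; apply Rplus_le_compat_l.
      eapply Rle_trans; [apply Cmod_sum_n |].
      apply sum_Rle; intros; rewrite Cmod_mult; lra.
    - rewrite <- g_rec.
      replace (2 * g k + conv g g k - conv g g k)%C with (2 * g k)%C by ring.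
      rewrite Cmod_mult, Cmod_R, Rabs_pos_eq; lra. }
  pose proof (sum_conv_le (fun k => Cmod (g k)) n) as Hc; cbv beta in Hc.
  rewrite g0, Cmod_0 in Hc.
  specialize (Hc eq_refl (fun k => Cmod_ge_0 _)).
  pose proof (sum_growing _ _ (S n) Hterm) as Ht.
  rewrite <- scal_sum, sum_plus in Ht.
  (* Since [0 <= s n <= sigma <= 1], the square [s n ^ 2] is at most [sigma], so
     [2 * s (S n) <= 2 * sigma]. *)
  pose proof (P_sum (S n)); nra.
Qed.

(** The equation is [(1 + G) ^ 2 = 1 + Ps] with the constant term removed. The bounded sums of
    moduli make [g] absolutely convergent, so its Cauchy square sums to [G * G]. *)
Lemma sqrt_series (P g : nat -> C) (sigma : R) (Ps : C) :
  g 0%nat = 0%C ->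
  (forall n, (2 * g n + conv g g n)%C = P n) ->
  sigma <= 1 ->
  (forall n, sum_f_R0 (fun k => Cmod (P k)) n <= sigma) ->
  @is_series C_AbsRing C_NormedModule P Ps ->
  exists G : C, @is_series C_AbsRing C_NormedModule g G /\
    Cmod G <= sigma /\ (2 * G + G * G)%C = Ps.
Proof.
  intros g0 g_rec sigma_le1 P_sum HP.
  pose proof (sqrt_coeff_sum_le P g sigma g0 g_rec sigma_le1 P_sum) as g_sum.
  assert (Hex : ex_series (fun k => Cmod (g k)))
    by (apply (ex_series_bounded _ sigma); [intros; apply Cmod_ge_0 | exact g_sum]).
  assert (HX : ex_series (fun k => Rabs (Re (g k)))).
  { apply (@ex_series_le R_AbsRing R_CompleteNormedModule _ (fun k => Cmod (g k))); [| exact Hex].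
    intros n; unfold norm; simpl; unfold abs; simpl.
    rewrite Rabs_Rabsolu; apply re_le_Cmod. }
  assert (HY : ex_series (fun k => Rabs (Im (g k)))).
  { apply (@ex_series_le R_AbsRing R_CompleteNormedModule _ (fun k => Cmod (g k))); [| exact Hex].
    intros n; unfold norm; simpl; unfold abs; simpl.
    rewrite Rabs_Rabsolu; apply im_le_Cmod. }
  destruct (ex_series_Rabs _ HX) as [x Hx].
  destruct (ex_series_Rabs _ HY) as [y Hy].
  assert (HG : @is_series C_AbsRing C_NormedModule g (x, y))
    by (apply is_series_C; split; assumption).
  exists (x, y); split; [exact HG |]; split.
  (* The bound on the partial sums passes to the limit by continuity of the norm. *)
  - assert (L : is_lim_seq (fun n => Cmod (sum_n g n)) (Cmod (x, y))).
    { apply (filterlim_comp _ _ _ _ _ _ _ _ HG).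
      exact (@filterlim_norm C_AbsRing C_NormedModule (x, y)). }
    apply (is_lim_seq_le _ (fun _ => sigma) (Cmod (x, y)) sigma
      (fun n => Rle_trans _ _ _ (Cmod_sum_n g n) (g_sum n)) L).
    apply is_lim_seq_const.
  (* Four real Cauchy products are recombined into the real part [Q1] and the imaginary part [Q2] of
     [2 * G + G * G]. *)
  - pose proof (is_series_mult _ _ _ _ Hx Hx HX HX) as Hxx.
    pose proof (is_series_mult _ _ _ _ Hx Hy HX HY) as Hxy.
    pose proof (is_series_mult _ _ _ _ Hy Hx HY HX) as Hyx.
    pose proof (is_series_mult _ _ _ _ Hy Hy HY HY) as Hyy.
    apply is_series_C in HP; destruct HP as [HP1 HP2].
    pose proof (is_series_plus _ _ _ _ (is_series_scal_l 2 _ _ Hx)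
      (is_series_minus _ _ _ _ Hxx Hyy)) as Q1.
    pose proof (is_series_plus _ _ _ _ (is_series_scal_l 2 _ _ Hy)
      (is_series_plus _ _ _ _ Hxy Hyx)) as Q2.
    apply (is_series_ext _ (fun n => Re (P n))) in Q1.
    2:{ intros n; rewrite <- g_rec.
        change (2 * Re (g n) + (sum_f_R0 (fun k => Re (g k) * Re (g (n - k)%nat)) n
          - sum_f_R0 (fun k => Im (g k) * Im (g (n - k)%nat)) n) =
          (2 * Re (g n) - 0 * Im (g n)) + Re (conv g g n)).
        unfold conv; rewrite re_sum_f_R0, <- minus_sum; simpl Re; ring_simplify; f_equal. }
    apply (is_series_ext _ (fun n => Im (P n))) in Q2.
    2:{ intros n; rewrite <- g_rec.
        change (2 * Im (g n) + (sum_f_R0 (fun k => Re (g k) * Im (g (n - k)%nat)) n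
          + sum_f_R0 (fun k => Im (g k) * Re (g (n - k)%nat)) n) =
          (2 * Im (g n) + 0 * Re (g n)) + Im (conv g g n)).
        unfold conv; rewrite im_sum_f_R0, <- sum_plus; simpl Im; ring_simplify; f_equal. }
    pose proof (is_series_unique _ _ Q1) as U1; rewrite (is_series_unique _ _ HP1) in U1.
    pose proof (is_series_unique _ _ Q2) as U2; rewrite (is_series_unique _ _ HP2) in U2.
    unfold plus, minus, opp, scal, mult in U1, U2; simpl in U1, U2.
    unfold mult in U1, U2; simpl in U1, U2.
    destruct Ps as [u v]; simpl in U1, U2; subst u v.
    unfold Cplus, Cmult; simpl; f_equal; ring.
Qed.

(** * Coefficients of the formal square root *)

(** Each coefficient depends on all earlier ones, so the recursion carries the whole table up to
    [n], with 0 beyond. The new entry solves [2 * g + conv g g = P] at [S m]. *)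
Fixpoint sqrt_table (P : nat -> C) (n : nat) : nat -> C :=
  match n with
  | O => fun _ => 0%C
  | S m => fun k =>
      if Nat.eqb k (S m)
      then ((P (S m) - conv (sqrt_table P m) (sqrt_table P m) (S m)) / 2)%C
      else sqrt_table P m k
  end.

Definition sqrt_coeff (P : nat -> C) (n : nat) : C := sqrt_table P n n.

Lemma sqrt_table_coeff (P : nat -> C) (n k : nat) :
  sqrt_table P n k = if Nat.leb k n then sqrt_coeff P k else 0%C.
Proof.
  induction n as [| n IH].
  - destruct k; reflexivity.
  - destruct (Nat.eq_dec k (S n)) as [-> | Hk].
    + rewrite Nat.leb_refl; reflexivity.
    + cbn [sqrt_table]; rewrite (proj2 (Nat.eqb_neq _ _) Hk), IH.
      destruct (Nat.leb_spec k n), (Nat.leb_spec k (S n)); auto; lia.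
Qed.

Lemma sqrt_coeff_rec (P : nat -> C) (n : nat) :
  P 0%nat = 0%C ->
  (2 * sqrt_coeff P n + conv (sqrt_coeff P) (sqrt_coeff P) n)%C = P n.
Proof.
  intros HP; destruct n as [| n].
  - unfold conv; rewrite sum_O, HP; unfold sqrt_coeff; simpl; ring.
  - replace (conv (sqrt_coeff P) (sqrt_coeff P) (S n))
      with (conv (sqrt_table P n) (sqrt_table P n) (S n)).
    + unfold sqrt_coeff at 1; cbn [sqrt_table]; rewrite Nat.eqb_refl.
      field; intros E; apply RtoC_inj in E; lra.
    + unfold conv; apply sum_n_ext_loc; intros k Hk.
      rewrite !sqrt_table_coeff.
      assert (E0 : sqrt_coeff P 0 = 0%C) by reflexivity.
      (* The end terms [k = 0] and [k = S n] involve index [S n], where the table still holds the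
         default 0; the factor [sqrt_coeff P 0 = 0] makes both sides vanish there. *)
      destruct (Nat.eq_dec k 0) as [-> | H0].
      { replace (S n - 0)%nat with (S n) by lia; simpl Nat.leb; rewrite E0, !Cmult_0_l; reflexivity. }
      destruct (Nat.eq_dec k (S n)) as [-> | H1].
      { rewrite Nat.sub_diag; rewrite E0, !Cmult_0_r; reflexivity. }
      rewrite (proj2 (Nat.leb_le k n)), (proj2 (Nat.leb_le (S n - k) n)) by lia.
      reflexivity.
Qed.

(** Convolution respects degree, so the recursion for coefficients is also one for the terms of the
    series at [h]. *)
Lemma conv_pow (a b : nat -> C) (h : C) (n : nat) :
  conv (fun k => (h ^ k * a k)%C) (fun k => (h ^ k * b k)%C) n = (h ^ n * conv a b n)%C.
Proof.
  unfold conv.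
  transitivity (sum_n (fun k => mult (h ^ n : C_Ring)%C (a k * b (n - k)%nat)%C) n).
  - apply sum_n_ext_loc; intros k Hk.
    change (h ^ k * a k * (h ^ (n - k) * b (n - k)%nat) =
            h ^ n * (a k * b (n - k)%nat))%C.
    replace (h ^ n)%C with (h ^ k * h ^ (n - k))%C; [ring |].
    rewrite <- Cpow_add_r; f_equal; lia.
  - apply (@sum_n_mult_l C_Ring).
Qed.

(** * The square root of [1 + p * h + q * h ^ 2] near [h = 0] *)

Definition quad (p q : C) (n : nat) : C :=
  match n with 1%nat => p | 2%nat => q | _ => 0%C end.

Lemma sum_quad (p q h : C) (n : nat) :
  sum_n (fun k => (h ^ k * quad p q k)%C) (S (S n)) = (p * h + q * h * h)%C.
Proof.
  induction n as [| n IH].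
  - rewrite !sum_Sn, sum_O; unfold plus; simpl; ring.
  - rewrite sum_Sn, IH; unfold plus; simpl; ring.
Qed.

Lemma is_series_quad (p q h : C) :
  @is_series C_AbsRing C_NormedModule (fun k => (h ^ k * quad p q k)%C) (p * h + q * h * h)%C.
Proof.
  apply (filterlim_ext_loc (fun _ => (p * h + q * h * h)%C)).
  - exists 2%nat; intros n Hn; destruct n as [| [| n]]; try lia.
    symmetry; apply sum_quad.
  - apply filterlim_const.
Qed.

Lemma sum_Cmod_quad (p q h : C) (n : nat) :
  sum_f_R0 (fun k => Cmod (h ^ k * quad p q k)%C) n <=
  Cmod p * Cmod h + Cmod q * Cmod h * Cmod h.
Proof.
  eapply Rle_trans;
    [apply (sum_f_R0_mono _ n (S (S n))); [intros; apply Cmod_ge_0 | lia] |].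
  induction n as [| n IH].
  - simpl; rewrite !Cmod_mult, Cmod_0, Cmod_1; lra.
  - rewrite tech5; simpl quad; rewrite Cmod_mult, Cmod_0; lra.
Qed.

(** The coefficients are fixed before [h], and [sqrt_series] is applied to the terms at each [h].
    The bound [sigma] controls how far the root strays from 1, which later decides the branch. *)
Lemma sqrt_quad_pseries (p q : C) (sigma : R) :
  0 < sigma <= 1 ->
  exists (a : nat -> C) (r : R), 0 < r /\
    forall h : C, Cmod h < r ->
      exists G : C,
        @is_pseries C_AbsRing C_NormedModule a h (1 + G)%C /\
        Cmod G <= sigma /\
        ((1 + G) * (1 + G))%C = (1 + p * h + q * h * h)%C.
Proof.
  intros Hs.
  set (g := sqrt_coeff (quad p q)).
  pose proof (Cmod_ge_0 p) as Hp; pose proof (Cmod_ge_0 q) as Hq.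
  (* The summand 1 gives [D >= 1], hence [Cmod h <= 1] when [Cmod h < sigma / D]; then both terms of
     the quadratic together are at most [D * Cmod h < sigma]. *)
  set (D := 1 + Cmod p + Cmod q).
  exists (fun n => match n return C with O => 1%C | _ => g n end), (sigma / D).
  assert (HD : 1 <= D) by (unfold D; lra).
  split; [apply Rdiv_lt_0_compat; lra |].
  intros h Hh; pose proof (Cmod_ge_0 h) as Hh0.
  assert (HhD : Cmod h * D < sigma).
  { apply (Rmult_lt_compat_r D) in Hh; [| lra].
    replace (sigma / D * D) with sigma in Hh by (field; lra). exact Hh. }
  assert (Hh1 : Cmod h <= 1) by nra.
  assert (g0 : g 0%nat = 0%C) by reflexivity.
  destruct (sqrt_series (fun k => (h ^ k * quad p q k)%C)
    (fun k => (h ^ k * g k)%C) sigma (p * h + q * h * h)%C)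
    as [G [HG [HGs HGe]]].
  - rewrite g0; ring.
  - intros n; rewrite conv_pow, <- (sqrt_coeff_rec (quad p q) n eq_refl); fold g; ring.
  - lra.
  - intros n; eapply Rle_trans; [apply sum_Cmod_quad |]; unfold D in HhD.
    assert (Cmod q * Cmod h * Cmod h <= Cmod q * Cmod h) by (assert (0 <= Cmod q * Cmod h) by nra; nra).
    nra.
  - apply is_series_quad.
  - exists G; split; [| split; [exact HGs |]].
    (* The sequences differ only at index 0, with 1 in place of [g 0 = 0], so the constant terms are
       split off. *)
    + unfold is_pseries; apply is_series_decr_1.
      apply (is_series_ext (fun n => (h ^ (S n) * g (S n))%C)).
      { reflexivity. }
      change (@is_series C_AbsRing C_NormedModule
        (fun n => (h ^ (S n) * g (S n))%C) (1 + G + - (1 * 1))%C).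
      apply (@is_series_incr_1 C_AbsRing C_NormedModule (fun n => (h ^ n * g n)%C)).
      change (@is_series C_AbsRing C_NormedModule
        (fun n => (h ^ n * g n)%C) (1 + G + - (1 * 1) + 1 * g 0%nat)%C).
      replace (1 + G + - (1 * 1) + 1 * g 0%nat)%C with G by (rewrite g0; ring).
      exact HG.
    + replace ((1 + G) * (1 + G))%C with (1 + (2 * G + G * G))%C by ring.
      rewrite HGe; ring.
Qed.

(** * The branch, its half-plane and local expansions of [nu] *)

Lemma csqrt_sqr (eps : R) (z : C) : (csqrt eps z * csqrt eps z)%C = z.
Proof.
  destruct (carg_spec eps z) as [_ E].
  rewrite E at 3; unfold csqrt.
  transitivity (RtoC (sqrt (Cmod z) * sqrt (Cmod z)) *
    (cis (carg eps z / 2) * cis (carg eps z / 2)))%C; [rewrite RtoC_mult; ring |].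
  rewrite sqrt_sqrt, <- cis_add by apply Cmod_ge_0.
  do 2 f_equal; field.
Qed.

(* [csqrt eps] takes its values in the half-plane [0 <= side eps v], and in
   its interior exactly off the branch cut. *)
Definition side (eps : R) (v : C) : R := Im (v * cis (- (eps / 2)))%C.

(** Rotation by [- (eps / 2)] moves the half-argument into [[0, PI)], where the sine is nonnegative
    and vanishes only at 0. *)
Lemma side_csqrt (eps : R) (z : C) :
  side eps (csqrt eps z) = sqrt (Cmod z) * sin ((carg eps z - eps) / 2).
Proof.
  unfold side, csqrt; rewrite <- Cmult_assoc, <- cis_add.
  replace (carg eps z / 2 + - (eps / 2)) with ((carg eps z - eps) / 2) by field.
  unfold cis; simpl; ring.
Qed.

Lemma side_csqrt_ge0 (eps : R) (z : C) : 0 <= side eps (csqrt eps z).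
Proof.
  rewrite side_csqrt; destruct (carg_spec eps z) as [H _].
  apply Rmult_le_pos; [apply sqrt_pos | apply sin_ge_0; lra].
Qed.

Lemma side_csqrt_gt0 (eps : R) (z : C) :
  z <> 0%C -> z <> (RtoC (Cmod z) * cis eps)%C -> 0 < side eps (csqrt eps z).
Proof.
  intros H0 Hcut; rewrite side_csqrt; destruct (carg_spec eps z) as [H E].
  apply Rmult_lt_0_compat; [apply sqrt_lt_R0, Cmod_gt_0, H0 |].
  assert (carg eps z <> eps) by (intros Ee; rewrite Ee in E; auto).
  apply sin_gt_0; lra.
Qed.

Lemma side_add (eps : R) (u v : C) : side eps (u + v)%C = side eps u + side eps v.
Proof. unfold side; simpl; ring. Qed.

Lemma side_opp (eps : R) (v : C) : side eps (- v)%C = - side eps v.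
Proof. unfold side; simpl; ring. Qed.

Lemma Rabs_side_le (eps : R) (v : C) : Rabs (side eps v) <= Cmod v.
Proof.
  unfold side; eapply Rle_trans; [apply im_le_Cmod |].
  rewrite Cmod_mult, Cmod_cis; lra.
Qed.

(** Positivity of [side] on the disc is returned too: it shows that the points with positive [side]
    form an open set, which serves as the neighbourhood in [nu_analytic_on]. *)
Lemma nu_pseries (eps kappa : R) (l : C) :
  0 < side eps (nu eps kappa l) ->
  exists (a : nat -> C) (r : R), 0 < r /\
    forall w : C, Cmod (w - l)%C < r ->
      @is_pseries C_AbsRing C_NormedModule a (w - l)%C (nu eps kappa w) /\
      0 < side eps (nu eps kappa w).
Proof.
  intros Hl.
  set (s0 := nu eps kappa l) in *.
  assert (Hz : (s0 * s0)%C = (- l ^ 2 - 2 * RtoC kappa ^ 2)%C) by apply csqrt_sqr.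
  pose proof (Rabs_side_le eps s0) as Hle.
  rewrite Rabs_pos_eq in Hle by lra.
  assert (Hs0 : s0 <> 0%C) by (intros E; apply (f_equal Cmod) in E; rewrite Cmod_0 in E; lra).
  (* With this [sigma], the correction [s0 * G] changes [side] by at most half of [side eps s0]. *)
  set (sigma := side eps s0 / (2 * Cmod s0)).
  assert (Hsig : sigma * Cmod s0 = side eps s0 / 2) by (unfold sigma; field; lra).
  assert (Hsig0 : 0 < sigma) by (apply Rdiv_lt_0_compat; lra).
  (* These come from expanding [- (l + h) ^ 2 - 2 * kappa ^ 2] in [h] and dividing by its value
     [s0 * s0] at [h = 0]. *)
  destruct (sqrt_quad_pseries (- (2 * l) / (s0 * s0))%C (- (1) / (s0 * s0))%C sigma)
    as [a [r [Hr Ha]]]; [nra |].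
  exists (fun n => (s0 * a n)%C), r; split; [exact Hr |].
  intros w Hw; destruct (Ha _ Hw) as [G [HG [HGs HGe]]].
  assert (Hf : 0 < side eps (s0 * (1 + G))%C).
  { replace (s0 * (1 + G))%C with (s0 + s0 * G)%C by ring; rewrite side_add.
    pose proof (Rabs_side_le eps (s0 * G)%C) as B; rewrite Cmod_mult in B.
    apply Rabs_le_between in B.
    assert (Cmod s0 * Cmod G <= side eps s0 / 2) by (rewrite <- Hsig; nra).
    lra. }
  assert (E : nu eps kappa w = (s0 * (1 + G))%C).
  { assert (Hw2 : (nu eps kappa w * nu eps kappa w)%C = (- w ^ 2 - 2 * RtoC kappa ^ 2)%C)
      by apply csqrt_sqr.
    assert (Hf2 : (s0 * (1 + G) * (s0 * (1 + G)))%C = (- w ^ 2 - 2 * RtoC kappa ^ 2)%C).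
    { replace (s0 * (1 + G) * (s0 * (1 + G)))%C with (s0 * s0 * ((1 + G) * (1 + G)))%C by ring.
      rewrite HGe.
      transitivity (s0 * s0 - 2 * l * (w - l) - (w - l) * (w - l))%C; [field; exact Hs0 |].
      rewrite Hz; ring. }
    pose proof (side_csqrt_ge0 eps (- w ^ 2 - 2 * RtoC kappa ^ 2)%C) as Hge.
    fold (nu eps kappa w) in Hge.
    destruct (Ceq_dec (nu eps kappa w) (s0 * (1 + G))%C) as [E | N]; [exact E | exfalso].
    (* Two distinct roots of one number are opposite, but one [side] is nonnegative and the other
       positive, so they cannot cancel. *)
    assert (Ep : (nu eps kappa w + s0 * (1 + G))%C = 0%C).
    { assert (N' : (nu eps kappa w - s0 * (1 + G))%C <> 0%C)
        by (apply Cminus_eq_contra, N).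
      apply (f_equal (fun x => (x / (nu eps kappa w - s0 * (1 + G)))%C)) in Hw2.
      rewrite <- Hf2 in Hw2.
      replace (nu eps kappa w + s0 * (1 + G))%C with
        (nu eps kappa w * nu eps kappa w / (nu eps kappa w - s0 * (1 + G)) -
         (s0 * (1 + G) * (s0 * (1 + G))) / (nu eps kappa w - s0 * (1 + G)))%C
        by (field; exact N').
      rewrite Hw2; ring. }
    apply (f_equal (side eps)) in Ep; rewrite side_add in Ep.
    replace (side eps 0%C) with 0 in Ep by (unfold side; simpl; ring).
    lra. }
  rewrite E; split; [| exact Hf].
  apply (is_series_ext (fun n => scal s0 (scal (pow_n (w - l)%C n) (a n)))).
  - intros n.
    change (s0 * ((w - l) ^ n * a n) = (w - l) ^ n * (s0 * a n))%C; ring.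
  - exact (@is_series_scal C_AbsRing C_NormedModule s0 _ _ HG).
Qed.

Lemma nu_analytic_on (eps kappa : R) (S : C -> Prop) :
  (forall l, S l -> 0 < side eps (nu eps kappa l)) ->
  analytic_on (nu eps kappa) S.
Proof.
  intros HS l Hl; exists (fun w => 0 < side eps (nu eps kappa w)).
  split; [| split; [exact (HS l Hl) |]].
  - intros w Hw; destruct (nu_pseries eps kappa w Hw) as [a [r [Hr H]]].
    (* Balls in the uniform structure of [C] are squares; the one of half-width [r / sqrt 2] fits in
       the disc of radius [r]. *)
    assert (Hr2 : 0 < r / sqrt 2) by (apply Rdiv_lt_0_compat; [lra | apply sqrt_lt_R0; lra]).
    exists (mkposreal _ Hr2); intros y Hy.
    apply H; replace r with (sqrt 2 * (r / sqrt 2)).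
    + exact (C_NormedModule_mixin_compat2 w y _ Hy).
    + field; apply Rgt_not_eq, sqrt_lt_R0; lra.
  - intros w Hw; destruct (nu_pseries eps kappa w Hw) as [a [r [Hr H]]].
    exists a, r; split; [exact Hr |]; intros y Hy; apply H, Hy.
Qed.

(** * The region, its closure and the zeros of the radicand *)

Definition Dk_fun (kappa : R) (l : C) : R :=
  - (4 * ((kappa * kappa + Re l * Re l - Im l * Im l) * (Re l * Im l))).

(** [Re (Ci * w ^ 2) = - 2 * Re w * Im w], with [w = kappa ^ 2 + l ^ 2]. *)
Lemma Dk_fun_spec (kappa : R) (l : C) : Dk kappa l <-> 0 < Dk_fun kappa l.
Proof.
  unfold Dk, Dk_fun.
  replace (Re (Ci * (RtoC kappa ^ 2 + l ^ 2) ^ 2)%C)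
    with (- (4 * ((kappa * kappa + Re l * Re l - Im l * Im l) * (Re l * Im l))));
    [reflexivity |].
  destruct l as [x y]; simpl; ring.
Qed.

(** By continuity, a point where [Dk_fun] is negative has a neighbourhood of such points, disjoint
    from [Dk kappa]. *)
Lemma closure_Dk (kappa : R) (l : C) : closure (Dk kappa) l -> 0 <= Dk_fun kappa l.
Proof.
  intros H; destruct (Rle_lt_dec 0 (Dk_fun kappa l)) as [Hp | Hn]; [exact Hp | exfalso].
  destruct (H (fun w => Dk_fun kappa w < 0)) as [w [Hw1 Hw2]].
  - assert (Hc : @continuous C_UniformSpace R_UniformSpace (Dk_fun kappa) l).
    { assert (Hre : @continuous C_UniformSpace R_UniformSpace Re l)
        by (destruct l; apply (@continuous_fst R_UniformSpace R_UniformSpace)).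
      assert (Him : @continuous C_UniformSpace R_UniformSpace Im l)
        by (destruct l; apply (@continuous_snd R_UniformSpace R_UniformSpace)).
      apply (@continuous_opp C_UniformSpace R_AbsRing R_NormedModule).
      apply (@continuous_mult C_UniformSpace R_AbsRing); [apply continuous_const |].
      apply (@continuous_mult C_UniformSpace R_AbsRing);
        [| now apply (@continuous_mult C_UniformSpace R_AbsRing)].
      apply (@continuous_minus C_UniformSpace R_AbsRing R_NormedModule);
        [apply (@continuous_plus C_UniformSpace R_AbsRing R_NormedModule);
          [apply continuous_const |] |];
        now apply (@continuous_mult C_UniformSpace R_AbsRing). }
    exact (Hc _ (open_lt 0 _ Hn)).
  - apply Dk_fun_spec in Hw2; lra.
Qed.

(* With [z = - l ^ 2 - 2 * kappa ^ 2], the set [0 <= Dk_fun kappa l] is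
   [0 <= - (Re z + kappa ^ 2) * Im z], so it misses the first quadrant. *)
Lemma Dk_fun_quadrant (kappa : R) (l : C) :
  0 <= Dk_fun kappa l ->
  0 < Re (- l ^ 2 - 2 * RtoC kappa ^ 2)%C ->
  0 < Im (- l ^ 2 - 2 * RtoC kappa ^ 2)%C -> False.
Proof.
  destruct l as [x y]; unfold Dk_fun; simpl; intros H1 H2 H3.
  ring_simplify in H1; ring_simplify in H2; ring_simplify in H3.
  assert (0 < (- x ^ 2 + y ^ 2 - 2 * kappa ^ 2) * (- 2 * x * y)) by (apply Rmult_lt_0_compat; lra).
  assert (0 <= kappa ^ 2 * (- 2 * x * y)) by (apply Rmult_le_pos; [apply pow2_ge_0 | lra]).
  lra.
Qed.

(** The imaginary part gives [x * y = 0]; if [y = 0], the real part [- x ^ 2 - 2 * kappa ^ 2 = 0]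
    still forces [x = 0], so [y ^ 2 = 2 * kappa ^ 2]. *)
Lemma nu_zero (kappa : R) (l : C) :
  (- l ^ 2 - 2 * RtoC kappa ^ 2)%C = 0%C ->
  l = (Ci * RtoC (sqrt 2) * RtoC (Rabs kappa))%C \/
  l = (- (Ci * RtoC (sqrt 2) * RtoC (Rabs kappa)))%C.
Proof.
  destruct l as [x y]; intros E; injection E; simpl; intros E2 E1.
  ring_simplify in E1; ring_simplify in E2.
  assert (Hx : x = 0).
  { assert (x * y = 0) as H by lra; apply Rmult_integral in H.
    destruct H as [H | H]; [exact H | subst y]; nra. }
  subst x.
  set (t := sqrt 2 * Rabs kappa).
  assert (Ht : t * t = y * y).
  { unfold t; transitivity (sqrt 2 * sqrt 2 * (Rabs kappa * Rabs kappa)); [ring |].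
    rewrite sqrt_sqrt by lra; rewrite <- Rabs_mult, Rabs_pos_eq by nra; lra. }
  assert (H : (y - t) * (y + t) = 0) by lra.
  apply Rmult_integral in H; destruct H as [H | H]; [left | right];
    unfold Cmult, Copp, Ci, RtoC; simpl; f_equal; unfold t in H; lra.
Qed.

Theorem lemma4p3 : forall kappa : R,
  exists eps0 : R, 0 < eps0 /\
    forall eps : R, 0 < eps < eps0 ->
      analytic_on (nu eps kappa)
        (fun lambda : C =>
           closure (Dk kappa) lambda /\
           lambda <> (Ci * RtoC (sqrt 2) * RtoC (Rabs kappa))%C /\
           lambda <> (- (Ci * RtoC (sqrt 2) * RtoC (Rabs kappa)))%C) /\
      (forall lambda : C, Dk kappa lambda -> 0 <= Im (nu eps kappa lambda)).
Proof.
  intros kappa; pose proof PI_RGT_0 as Hpi.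
  (* Below [PI / 2], the cut [arg z = eps] lies in the open first quadrant, and so do the arguments
     strictly between [2 * PI] and [2 * PI + eps]. *)
  exists (PI / 2); split; [lra |]; intros eps Heps; split.
  - apply nu_analytic_on; intros l [Hcl [Hl1 Hl2]].
    assert (Hz : (- l ^ 2 - 2 * RtoC kappa ^ 2)%C <> 0%C)
      by (intros E; destruct (nu_zero _ _ E); contradiction).
    apply side_csqrt_gt0; [exact Hz |]; intros E.
    apply Cmod_gt_0 in Hz.
    apply (Dk_fun_quadrant kappa l (closure_Dk _ _ Hcl)); rewrite E; simpl.
    + rewrite Rmult_0_l, Rminus_0_r; apply Rmult_lt_0_compat; [exact Hz |].
      apply cos_gt_0; lra.
    + rewrite Rmult_0_l, Rplus_0_r; apply Rmult_lt_0_compat; [exact Hz |].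
      apply sin_gt_0; lra.
  - intros l Hl; apply Dk_fun_spec in Hl.
    unfold nu, csqrt; set (z := (- l ^ 2 - 2 * RtoC kappa ^ 2)%C).
    destruct (carg_spec eps z) as [Ht E]; set (t := carg eps z) in *.
    simpl; rewrite Rmult_0_l, Rplus_0_r.
    (* [sin (t / 2)] is negative only for [t > 2 * PI]; a nonzero [z] with such an argument lies in
       the first quadrant, as subtracting a full turn shows. *)
    destruct (Rle_lt_dec t (2 * PI)) as [Hle | Hgt].
    + apply Rmult_le_pos; [apply sqrt_pos | apply sin_ge_0; lra].
    + destruct (Ceq_dec z 0%C) as [Hz | Hz].
      (* At [z = 0] the angle is unspecified, but the modulus factor vanishes. *)
      { rewrite Hz, Cmod_0, sqrt_0; lra. }
      apply Cmod_gt_0 in Hz; exfalso.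
      apply (Dk_fun_quadrant kappa l (Rlt_le _ _ Hl)); fold z; rewrite E; simpl;
        replace t with ((t - 2 * PI) + 2 * INR 1 * PI) by (simpl; ring).
      * rewrite cos_period, Rmult_0_l, Rminus_0_r; apply Rmult_lt_0_compat; [exact Hz |].
        apply cos_gt_0; lra.
      * rewrite sin_period, Rmult_0_l, Rplus_0_r; apply Rmult_lt_0_compat; [exact Hz |].
        apply sin_gt_0; lra.
Qed.
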